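(* Let $(Y_1,X_1),\dots,(Y_n,X_n)$ be observations with $Y_i\in\mathbb{R}$ and $X_i\in\mathbb{R}^p$, and let $m_{\hat\theta}:\mathbb{R}^p\to\mathbb{R}$ be a prediction function, where $\hat\theta=\hat\theta(Y_1,X_1,\dots,Y_n,X_n)$ is a statistic. Put $\bar Y=n^{-1}\sum_{i=1}^nY_i$ and $\bar m_{\hat\theta}=n^{-1}\sum_{i=1}^nm_{\hat\theta}(X_i)$, assume $\sum_{i=1}^n\{m_{\hat\theta}(X_i)-\bar m_{\hat\theta}\}^2>0$, and define $$m^{(c)}_{\hat\theta}(x)=\hat a+\hat b\,m_{\hat\theta}(x),\qquad \hat b=\frac{\sum_{i=1}^n(Y_i-\bar Y)\{m_{\hat\theta}(X_i)-\bar m_{\hat\theta}\}}{\sum_{i=1}^n\{m_{\hat\theta}(X_i)-\bar m_{\hat\theta}\}^2},\qquad \hat a=\bar Y-\hat b\,\bar m_{\hat\theta}.$$ (That is, $m^{(c)}_{\hat\theta}$ is the ordinary least squares regression function obtained by linearly regressing $Y_1,\dots,Y_n$ on $m_{\hat\theta}(X_1),\dots,m_{\hat\theta}(X_n)$.) Then: (a) (Variance decomposition) $$\sum_{i=1}^n(Y_i-\bar Y)^2=\sum_{i=1}^n(m^{(c)}_{\hat\theta}(X_i)-\bar Y)^2+\sum_{i=1}^n(Y_i-m^{(c)}_{\hat\theta}(X_i))^2.$$ (b) (Prediction error decomposition) $$\sum_{i=1}^n(Y_i-m_{\hat\theta}(X_i))^2=\sum_{i=1}^n(Y_i-m^{(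c)}_{\hat\theta}(X_i))^2+\sum_{i=1}^n(m^{(c)}_{\hat\theta}(X_i)-m_{\hat\theta}(X_i))^2.$$
   Context: The prediction function $m_\theta$, $\theta\in\Theta$, is obtained as a functional of a conditional distribution function $F_\theta(\cdot|x)$ in a possibly misspecified regression model $\{F_\theta(y|x):\theta\in\Theta\}$ of $Y$ on $X$. The pairs $(Y_i,X_i)$ are i.i.d. copies of $(Y,X)$. For the statement, $m_{\hat\theta}$ may be any real-valued function, possibly depending on the data. *)

(* Defs.v *)
From mathcomp Require Import all_boot all_order all_algebra.
From mathcomp Require Import reals.

Set Implicit Arguments.
Unset Strict Implicit.
Unset Printing Implicit Defensive.

Import Order.TTheory GRing.Theory Num.Theory.
Local Open Scope ring_scope.

Definition sample_mean (R : realType) (n : nat) (u : 'I_n -> R) : R :=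
  n%:R^-1 * \sum_(i < n) u i.

Definition centered_ss (R : realType) (n : nat) (u : 'I_n -> R) : R :=
  \sum_(i < n) (u i - sample_mean u) ^+ 2.

(* Least squares coefficients for the simple linear regression of the
   responses u on the regressor values v; the division is meaningful only
   when centered_ss v is nonzero. *)
Definition ols_slope (R : realType) (n : nat) (u v : 'I_n -> R) : R :=
  (\sum_(i < n) (u i - sample_mean u) * (v i - sample_mean v))
  / centered_ss v.

Definition ols_intercept (R : realType) (n : nat) (u v : 'I_n -> R) : R :=
  sample_mean u - ols_slope u v * sample_mean v.

Definition corrected (R : realType) (n p : nat)
    (Y : 'I_n -> R) (X : 'I_n -> 'rV[R]_p) (f : 'rV[R]_p -> R)
    (x : 'rV[R]_p) : R :=
  ols_intercept Y (fun i => f (X i)) + ols_slope Y (fun i => f (X i)) * f x.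

(* Main.v *)
Require Import Defs.
From mathcomp Require Import all_boot all_order all_algebra.
From mathcomp Require Import reals.
From mathcomp Require Import ring.

(** Both decompositions are instances of Pythagoras' theorem in R^n.  The
    recalibrated predictions form the orthogonal projection of the response
    vector onto the plane spanned by the constant vector and the vector of
    original predictions.  The least squares residual is therefore orthogonal
    to every affine function of the original predictions
    ([ols_residual_orthogonal_affine]).  The second leg of each triangle is
    such an affine function: the recalibrated prediction minus the mean
    response in (a), and the recalibrated minus the original prediction
    in (b); [sum_sqr_orthogonal] then gives both identities. *)

Set Implicit Arguments.
Unset Strict Implicit.
Unset Printing Implicit Defensive.

Import Order.TTheory GRing.Theory Num.Theory.
Local Open Scope ring_scope.

Lemma sum_sqr_orthogonal (R : comPzRingType) (I : finType) (r w : I -> R) :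
  \sum_i r i * w i = 0 ->
  \sum_i (r i + w i) ^+ 2 = \sum_i r i ^+ 2 + \sum_i w i ^+ 2.
Proof.
move=> rw0; under eq_bigr do rewrite sqrrD.
by rewrite 2!big_split /= sumrMnl rw0 mul0rn addr0.
Qed.

Lemma sum_centered (R : realType) (n : nat) (u : 'I_n -> R) :
  \sum_(i < n) (u i - sample_mean u) = 0.
Proof.
(* For n = 0 the sample mean is the junk value 0, but the sum is empty. *)
case: n u => [|n] u; first by rewrite big_ord0.
rewrite sumrB sumr_const card_ord -mulr_natl mulrA mulfV ?pnatr_eq0 //.
by rewrite mul1r subrr.
Qed.

Definition ols_residual (R : realType) (n : nat) (u v : 'I_n -> R)
    (i : 'I_n) : R :=
  u i - (ols_intercept u v + ols_slope u v * v i).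

(** Eliminating the intercept leaves only centered variables, which turns the
    normal equations into a zero-mean statement and the definition of the
    slope. *)
Lemma ols_residualE (R : realType) (n : nat) (u v : 'I_n -> R) (i : 'I_n) :
  ols_residual u v i =
  (u i - sample_mean u) - ols_slope u v * (v i - sample_mean v).
Proof. by rewrite /ols_residual /ols_intercept; ring. Qed.

Lemma sum_ols_residual (R : realType) (n : nat) (u v : 'I_n -> R) :
  \sum_(i < n) ols_residual u v i = 0.
Proof.
under eq_bigr do rewrite ols_residualE.
by rewrite sumrB -mulr_sumr !sum_centered mulr0 subrr.
Qed.

Lemma sum_ols_residual_centered (R : realType) (n : nat) (u v : 'I_n -> R) :
  centered_ss v != 0 ->
  \sum_(i < n) ols_residual u v i * (v i - sample_mean v) = 0.
Proof.
move=> v_neq0.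
under eq_bigr do rewrite ols_residualE mulrBl -mulrA -expr2.
by rewrite sumrB -mulr_sumr divfK // subrr.
Qed.

(** The two normal equations of least squares, combined: constants and the
    regressor span all affine functions of the regressor. *)
Lemma ols_residual_orthogonal_affine (R : realType) (n : nat)
    (u v : 'I_n -> R) (c d : R) :
  centered_ss v != 0 ->
  \sum_(i < n) ols_residual u v i * (c + d * v i) = 0.
Proof.
move=> v_neq0.
(* Recentering the regressor only changes the constant term. *)
transitivity (\sum_(i < n) (ols_residual u v i * (c + d * sample_mean v)
    + ols_residual u v i * (v i - sample_mean v) * d)).
  by apply: eq_bigr => i _; ring.
rewrite big_split /= -!mulr_suml sum_ols_residual.
by rewrite sum_ols_residual_centered // !mul0r addr0.
Qed.

Theorem lemma2p2 (R : realType) (n p : nat) (Theta : Type)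
    (m : Theta -> 'rV[R]_p -> R)
    (thetahat : ('I_n -> R * 'rV[R]_p) -> Theta)
    (Y : 'I_n -> R) (X : 'I_n -> 'rV[R]_p) :
  let mhat := m (thetahat (fun i => (Y i, X i))) in
  let mc := corrected Y X mhat in
  let Ybar := sample_mean Y in
  let mbar := sample_mean (fun i => mhat (X i)) in
  0 < \sum_(i < n) (mhat (X i) - mbar) ^+ 2 ->
  (\sum_(i < n) (Y i - Ybar) ^+ 2 =
     \sum_(i < n) (mc (X i) - Ybar) ^+ 2 + \sum_(i < n) (Y i - mc (X i)) ^+ 2)
  /\
  (\sum_(i < n) (Y i - mhat (X i)) ^+ 2 =
     \sum_(i < n) (Y i - mc (X i)) ^+ 2 +
     \sum_(i < n) (mc (X i) - mhat (X i)) ^+ 2).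
Proof.
move=> mhat mc Ybar mbar ss_gt0.
set v := fun i => mhat (X i).
have v_neq0 : centered_ss v != 0 by rewrite gt_eqF.
have pythagoras (t w : 'I_n -> R) (c d : R) :
    (forall i, w i = c + d * v i) ->
    (forall i, t i = ols_residual Y v i + w i) ->
    \sum_(i < n) t i ^+ 2 =
      \sum_(i < n) (Y i - mc (X i)) ^+ 2 + \sum_(i < n) w i ^+ 2.
  move=> wE tE; under eq_bigr do rewrite tE.
  apply: (@sum_sqr_orthogonal _ _ (ols_residual Y v)).
  under eq_bigr do rewrite wE.
  exact: ols_residual_orthogonal_affine.
split.
  rewrite addrC.
  apply: (pythagoras _ _ (ols_intercept Y v - Ybar) (ols_slope Y v)) => i.
    by rewrite /mc /corrected -/v addrAC.
  by rewrite [ols_residual _ _ _]/(Y i - mc (X i)) addrA subrK.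
apply: (pythagoras _ _ (ols_intercept Y v) (ols_slope Y v - 1)) => i.
  by rewrite /mc /corrected -/v /v; ring.
by rewrite [ols_residual _ _ _]/(Y i - mc (X i)) addrA subrK.
Qed.
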